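(* Let $n$ be a positive integer. Then $$\Theta(K_n)=\min\{k : k \text{ a positive integer with } \chi_k\ge n\}.$$ Moreover, a group $G$ is $K_n$-optimal if and only if $G$ is a cyclic group of order $\Theta(K_n)$.
   Context: Graphs are finite, simple and undirected. The power graph $\Gamma_G$ of a group $G$ has vertex set $G$, and two distinct elements are adjacent if one is a power of the other. An embedding of a graph $\Gamma_1$ into a graph $\Gamma_2$ is an injection $f:V(\Gamma_1)\to V(\Gamma_2)$ such that $\{x,y\}\in E(\Gamma_1)$ implies $\{f(x),f(y)\}\in E(\Gamma_2)$ (the image need not be an induced subgraph). The power index $\Theta(\Gamma)$ of a graph $\Gamma$ is the least order of a group $G$ such that $\Gamma$ embeds into $\Gamma_G$. A group $G$ is $\Gamma$-optimal if $\Gamma$ embeds into $\Gamma_G$ and $|G|=\Theta(\Gamma)$. $K_n$ is the complete graph on $n$ vertices. For a positive integer $n=p_1^{r_1}p_2^{r_2}\cdots p_m^{r_m}$ with primes $p_1<p_2<\cdots<p_m$ and all $r_i\ge 1$, define $$\chi_n=\varphi(n)+\varphi\left(\frac{n}{p_1}\right)+\cdots+\varphi\left(\frac{n}{p_1^{r_1}}\right)+\varphi\left(\frac{n}{p_1^{r_1}p_2}\right)+\cdots+\varphi\left(\frac{n}{p_1^{r_1}p_2^{r_2}}\right)+\varphi\left(\frac{n}{p_1^{r_1}p_2^{r_2}p_3}\right)+\cdots+\varphi\left(\frac{n}{p_1^{r_1}\cdots p_{m-1}^{r_{m-1}}p_m^{r_m-1}}\right)+\varphi(1),$$ where $\varphi$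 is Euler's totient function; that is, $\chi_n$ is the sum of $\varphi(d)$ over the divisors $d$ in the chain starting at $n$ and ending at $1$ obtained by repeatedly dividing by the least prime factor. In particular $\chi_1=1$, and $\chi_n=\varphi(n)+\chi_{n/p}$ for $n\geq 2$ with $p$ the least prime factor of $n$. *)

(* Defs.v *)
From HB Require Import structures.
From mathcomp Require Import all_boot all_order all_algebra all_fingroup all_solvable.
From mathcomp Require Import boolp.

Set Implicit Arguments.
Unset Strict Implicit.
Unset Printing Implicit Defensive.

Record sgraph := SGraph {
  vertex : finType;
  edge : rel vertex;
  edge_sym : symmetric edge;
  edge_irr : irreflexive edge }.

(* The image of an embedding need not be an induced subgraph. *)
Definition embeds (G1 G2 : sgraph) : Prop :=
  exists2 f : vertex G1 -> vertex G2,
    injective f & forall x y, edge x y -> edge (f x) (f y).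

Section CompleteGraph.
Variable n : nat.

Definition complete_edge : rel 'I_n := fun x y => x != y.

Lemma complete_edge_sym : symmetric complete_edge.
Proof. by move=> x y; rewrite /complete_edge eq_sym. Qed.

Lemma complete_edge_irr : irreflexive complete_edge.
Proof. by move=> x; rewrite /complete_edge eqxx. Qed.

Definition complete_graph : sgraph := SGraph complete_edge_sym complete_edge_irr.

End CompleteGraph.

Section PowerGraph.
Variable gT : finGroupType.

Definition power_edge : rel gT :=
  fun x y => (x != y) && ((x \in <[y]>%g) || (y \in <[x]>%g)).

Lemma power_edgeP (x y : gT) :
  reflect (x <> y /\ ((exists k : nat, x = (y ^+ k)%g) \/
                      (exists k : nat, y = (x ^+ k)%g)))
          (power_edge x y).
Proof.
apply: (iffP andP) => [[/eqP neq_xy /orP xy]|[/eqP neq_xy xy]]; split=> //.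
  by case: xy => /cycleP; [left | right].
by apply/orP; case: xy => /cycleP; [left | right].
Qed.

Lemma power_edge_sym : symmetric power_edge.
Proof. by move=> x y; rewrite /power_edge eq_sym orbC. Qed.

Lemma power_edge_irr : irreflexive power_edge.
Proof. by move=> x; rewrite /power_edge eqxx. Qed.

Definition power_graph : sgraph := SGraph power_edge_sym power_edge_irr.

End PowerGraph.

Definition embeds_in_order (Gamma : sgraph) (k : nat) : Prop :=
  exists2 gT : finGroupType, #|gT| = k & embeds Gamma (power_graph gT).

Lemma power_edge_cyclic_pgroup (gT : finGroupType) (p r : nat) (x y : gT) :
  prime p -> #|gT| = (p ^ r)%N -> cyclic [set: gT] ->
  power_edge x y = (x != y).
Proof.
move=> p_pr cardT cyc; rewrite /power_edge; case: eqP => //= _.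
have order_pow (z : gT) : exists i, #[z]%g = (p ^ i)%N.
  have : (#[z]%g %| p ^ r)%N by rewrite -cardT -cardsT order_dvdG // inE.
  by case/(dvdn_pfactor _ _ p_pr) => i _ ->; exists i.
have mem_cycle (u v : gT) : (u \in <[v]>%g) = (#[u]%g %| #[v]%g).
  by rewrite /order (cardSg_cyclic cyc) ?subsetT // cycle_subG.
rewrite !mem_cycle; have [i ->] := order_pow x; have [j ->] := order_pow y.
by case/orP: (leq_total i j) => le_ij; rewrite (dvdn_exp2l p le_ij) ?orbT.
Qed.

(* The power graph of a cyclic 2-group is complete, so every graph embeds
   into the power graph of some finite group. *)
Lemma embeds_in_some_order (Gamma : sgraph) :
  exists k, `[< embeds_in_order Gamma k >].
Proof.
have [N [N_gt1 V_lt [r defN]]] : exists N,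
    [/\ 1 < N, #|vertex Gamma| <= N & exists r, N = (2 ^ r)%N].
  exists (2 ^ #|vertex Gamma|.+1)%N; split; last by eexists.
    by rewrite -[X in X < _](expn0 2) ltn_exp2l.
  by rewrite (leq_trans (leqnSn _)) // ltnW // ltn_expl.
have cardZ : #|'Z_N| = N by rewrite card_ord Zp_cast.
exists N; apply/asboolP; exists 'Z_N => //.
have V_le : #|vertex Gamma| <= #|'Z_N| by rewrite cardZ.
pose f (v : vertex Gamma) : 'Z_N := enum_val (widen_ord V_le (enum_rank v)).
have f_inj : injective f.
  move=> u v /enum_val_inj /(congr1 val) /= eq_uv.
  by apply: enum_rank_inj; apply: val_inj.
exists f => // u v uv.
have cyc : cyclic [set: 'Z_N].
  by apply/cyclicP; exists (Zp1 : 'Z_N); rewrite Zp_cycle.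
rewrite /edge /= (power_edge_cyclic_pgroup (p := 2) (r := r)) //; last first.
  by rewrite cardZ.
by apply: contraTneq uv => /f_inj ->; rewrite edge_irr.
Qed.

Definition power_index (Gamma : sgraph) : nat :=
  ex_minn (embeds_in_some_order Gamma).

Definition optimal (Gamma : sgraph) (gT : finGroupType) : Prop :=
  embeds Gamma (power_graph gT) /\ #|gT| = power_index Gamma.

(* The prime factors of n > 0 in nondecreasing order, with multiplicity. *)
Definition prime_factors (n : nat) : seq nat :=
  flatten [seq nseq pr.2 pr.1 | pr <- prime_decomp n].

(* The j-th term is totient (n / d), where d is the product of the j smallest
   prime factors of n counted with multiplicity. *)
Definition chi (n : nat) : nat :=
  \sum_(0 <= j < (size (prime_factors n)).+1)
     totient (n %/ \prod_(p <- take j (prime_factors n)) p).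

Definition is_min (P : nat -> Prop) (m : nat) : Prop :=
  P m /\ forall k, P k -> m <= k.

(* Main.v *)
(** The elements of a clique of a power graph have orders forming a chain for
    divisibility, and those of a given order d all generate the same cyclic
    group, so there are at most totient d of them.  Hence a clique whose largest
    order is m has at most as many elements as the largest sum of totients along
    a chain of divisors of m.  Dividing by the least prime at each step maximizes
    that sum, because totient (m / q) <= totient (m / p) for primes p < q
    dividing m; so the bound is chi m, and a cyclic group of order m attains it.
    If a group of order Theta(K_n) has a clique of size n with largest order m,
    then chi m >= n forces m >= Theta(K_n), so the group is cyclic. *)
Require Import Defs.
From mathcomp Require Import all_boot all_fingroup all_solvable.
From mathcomp Require Import finalg zmodp boolp.

Set Implicit Arguments.
Unset Strict Implicit.
Unset Printing Implicit Defensive.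

(** * Recursion of [chi] along the least prime factor *)

(** Indexing by a range independent of [m] makes the factor lists of two integers comparable block
    by block; indices that are not prime divisors give empty blocks. *)
Lemma prime_factors_iota m N : 0 < m -> m < N ->
  prime_factors m = flatten [seq nseq (logn q m) q | q <- iota 0 N].
Proof.
move=> m_gt0 lt_mN; rewrite /prime_factors prime_decompE -map_comp.
have -> : primes m = [seq q <- iota 0 N | q \in primes m].
  apply: (irr_sorted_eq ltn_trans ltnn); first exact: sorted_primes.
    by rewrite sorted_filter ?iota_ltn_sorted //; apply: ltn_trans.
  move=> q; rewrite mem_filter mem_iota add0n /=; case: (boolP (q \in _)) => //=.
  rewrite mem_primes => /and3P[_ _ /(dvdn_leq m_gt0) le_qm].
  by rewrite (leq_ltn_trans le_qm).
elim: (iota 0 N) => //= q s IHs; case: ifP => /= [_|qm]; rewrite IHs //.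
by have -> : logn q m = 0 by apply/eqP; rewrite -leqn0 leqNgt logn_gt0 qm.
Qed.

(** Dividing by [p = pdiv m] lowers only the valuation at [p], and blocks below [p] are empty, so
    exactly one leading [p] disappears. *)
Lemma prime_factors_pdiv m : 1 < m ->
  prime_factors m = pdiv m :: prime_factors (m %/ pdiv m).
Proof.
move=> m_gt1; have m_gt0 := ltnW m_gt1; set p := pdiv m.
have p_pr : prime p := pdiv_prime m_gt1.
have p_m : p %| m := pdiv_dvd m; have le_pm := dvdn_leq m_gt0 p_m.
have k_gt0 : 0 < m %/ p by rewrite divn_gt0 ?prime_gt0.
have def_m : m = p * (m %/ p) by rewrite mulnC divnK.
have logE q : logn q m = (q == p) + logn q (m %/ p).
  by rewrite {1}def_m lognM ?(prime_gt0 p_pr) // logn_prime.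
rewrite !(@prime_factors_iota _ m.+1) ?ltnS ?leq_div //.
have -> : iota 0 m.+1 = iota 0 p ++ p :: iota p.+1 (m - p).
  by rewrite -{1}(subnKC (leqW le_pm)) iotaD add0n subSn.
have no_small k : 0 < k -> k %| m ->
  flatten [seq nseq (logn q k) q | q <- iota 0 p] = [::].
  move=> k0 k_m; have : {subset iota 0 p <= [pred q | q < p]}.
    by move=> q; rewrite mem_iota.
  elim: (iota 0 p) => //= q s IHs sub.
  have lt_qp : q < p by apply: (sub q); rewrite mem_head.
  have -> : logn q k = 0.
    apply/eqP; rewrite -leqn0 leqNgt logn_gt0 mem_primes.
    apply: contraL lt_qp => /and3P[q_pr _ q_k]; rewrite -leqNgt.
    by rewrite pdiv_min_dvd ?prime_gt1 ?(dvdn_trans q_k).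
  by apply: IHs => r rs; apply: sub; rewrite inE rs orbT.
rewrite !map_cat !flatten_cat !no_small ?dvdn_div //=.
rewrite logE eqxx; congr (_ :: (_ ++ flatten _)).
apply/eq_in_map => q; rewrite mem_iota logE => /andP[lt_pq _].
by rewrite gtn_eqF.
Qed.

Lemma chi1 : chi 1 = 1.
Proof. by rewrite /chi /prime_factors /= big_nat1 big_nil. Qed.

Lemma chi_pdiv m : 1 < m -> chi m = totient m + chi (m %/ pdiv m).
Proof.
move=> m_gt1; rewrite /chi prime_factors_pdiv // big_nat_recl //= big_nil divn1.
by congr (_ + _); apply: eq_bigr => j _; rewrite big_cons divnMA.
Qed.

Lemma totient_le_chi m : totient m <= chi m.
Proof. by rewrite /chi big_nat_recl // take0 big_nil divn1 leq_addr. Qed.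

(** * Maximality of [chi] among divisor chains *)

Lemma totient_mul_prime p b : prime p -> 0 < b ->
  totient (p * b) = (if p %| b then p else p.-1) * totient b.
Proof.
move=> p_pr b_gt0; have [c co_pc def_b] := pfactor_coprime p_pr b_gt0.
have co_e e : coprime c (p ^ e) by rewrite coprime_sym coprimeXl.
have -> : (p %| b) = (0 < logn p b) by rewrite logn_gt0 mem_primes p_pr b_gt0.
move: (logn p b) def_b => e ->.
rewrite mulnCA -expnS !totient_coprime // totient_pfactor //=.
case: e => [|e] /=; first by rewrite expn0 !muln1 mulnC.
by rewrite totient_pfactor //= expnS [RHS]mulnCA [p * (_ * _)]mulnCA.
Qed.

(** Both sides are compared through [totient m]: [p * totient (m %/ q) <= q.-1 * totient (m %/ q) <=
    totient m <= p * totient (m %/ p)]. *)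
Lemma totient_div_prime_le m p q : 0 < m -> prime p -> prime q ->
  p %| m -> q %| m -> p < q -> totient (m %/ q) <= totient (m %/ p).
Proof.
move=> m_gt0 p_pr q_pr p_m q_m lt_pq.
have div_gt0 r : prime r -> r %| m -> 0 < m %/ r.
  by move=> r_pr r_m; rewrite divn_gt0 ?prime_gt0 // dvdn_leq.
have totE r : prime r -> r %| m -> totient m =
    (if r %| m %/ r then r else r.-1) * totient (m %/ r).
  by move=> r_pr r_m; rewrite -totient_mul_prime ?div_gt0 // mulnC divnK.
rewrite -(leq_pmul2l (prime_gt0 p_pr)).
apply: (@leq_trans (totient m)).
  rewrite (totE q) // leq_mul2r; apply/orP; right.
  by case: ifP => _; [exact: ltnW | rewrite -ltnS prednK ?prime_gt0].
by rewrite (totE p) // leq_mul2r; case: ifP => _; rewrite ?leqnn ?leq_pred orbT.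
Qed.

(** Exchange argument: if [p = pdiv m < q], then [p] is still the least prime of [m %/ q]. Replacing
    the chain [m %/ q], [m %/ (q * p)] by [m %/ p], [m %/ (p * q)] does not decrease the sum, and
    induction applies at [m %/ p]. *)
Lemma chi_div_prime m q : 0 < m -> prime q -> q %| m ->
  totient m + chi (m %/ q) <= chi m.
Proof.
elim/ltn_ind: m q => m IHm q m_gt0 q_pr q_m.
have m_gt1 : 1 < m := leq_trans (prime_gt1 q_pr) (dvdn_leq m_gt0 q_m).
rewrite [chi m]chi_pdiv // leq_add2l; set p := pdiv m.
have p_pr : prime p := pdiv_prime m_gt1; have p_m : p %| m := pdiv_dvd m.
have := pdiv_min_dvd (prime_gt1 q_pr) q_m; rewrite -/p leq_eqVlt.
case/predU1P=> [-> // | lt_pq].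
have co_pq : coprime p q by rewrite prime_coprime // dvdn_prime2 // ltn_eqF.
have p_mq : p %| m %/ q by rewrite dvdn_divRL // Gauss_dvd ?p_m.
have q_mp : q %| m %/ p.
  by rewrite dvdn_divRL // mulnC Gauss_dvd ?p_m.
have mq_gt0 : 0 < m %/ q by rewrite divn_gt0 ?prime_gt0 // dvdn_leq.
have mp_gt0 : 0 < m %/ p by rewrite divn_gt0 ?prime_gt0 // dvdn_leq.
have mq_gt1 := leq_trans (prime_gt1 p_pr) (dvdn_leq mq_gt0 p_mq).
have pdiv_mq : pdiv (m %/ q) = p.
  apply/eqP; rewrite eqn_leq pdiv_min_dvd ?prime_gt1 //=.
  rewrite pdiv_min_dvd ?prime_gt1 ?pdiv_prime //.
  by rewrite (dvdn_trans (pdiv_dvd _)) ?dvdn_div.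
rewrite chi_pdiv // pdiv_mq.
apply: leq_trans (IHm _ _ q _ q_pr q_mp) => //; last first.
  by rewrite ltn_Pdiv ?prime_gt1.
by rewrite -!divnMA [q * p]mulnC leq_add2r totient_div_prime_le.
Qed.

(** A prime [q] dividing [m %/ d] gives an intermediate divisor [m %/ q] that is a multiple of [d];
    induction there yields [chi d <= chi (m %/ q)]. *)
Lemma chi_proper_dvd d m : 0 < m -> d %| m -> d < m ->
  totient m + chi d <= chi m.
Proof.
elim/ltn_ind: m => m IHm m_gt0 d_m lt_dm.
have d_gt0 := dvdn_gt0 m_gt0 d_m.
have q_pr : prime (pdiv (m %/ d)).
  by rewrite pdiv_prime // ltn_divRL // mul1n.
set q := pdiv (m %/ d) in q_pr.
have dq_m : q * d %| m by rewrite -dvdn_divRL ?pdiv_dvd.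
have q_m : q %| m by apply: dvdn_trans dq_m; apply: dvdn_mulr.
have mq_gt0 : 0 < m %/ q by rewrite divn_gt0 ?prime_gt0 // dvdn_leq.
have d_mq : d %| m %/ q by rewrite dvdn_divRL // mulnC.
apply: leq_trans (chi_div_prime m_gt0 q_pr q_m); rewrite leq_add2l.
have := dvdn_leq mq_gt0 d_mq; rewrite leq_eqVlt => /predU1P[<- // | lt_d_mq].
have lt_mq : m %/ q < m by rewrite ltn_Pdiv ?prime_gt1.
by apply: leq_trans (IHm _ lt_mq mq_gt0 d_mq lt_d_mq); apply: leq_addl.
Qed.

(** * Cliques of power graphs *)

Section Cliques.
Variable gT : finGroupType.
Implicit Types (x y : gT) (A : {set gT}).

Definition power_clique A :=
  {in A &, forall x y, (x \in <[y]>%g) || (y \in <[x]>%g)}.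

Lemma cycle_eq_order x y : y \in <[x]>%g -> #[y]%g = #[x]%g -> <[y]>%g = <[x]>%g.
Proof.
by move=> yx eq_o; apply/eqP; rewrite eqEcard cycle_subG yx -/(order x) -eq_o /=.
Qed.

(** Members of order [#[x]] generate [<[x]>]. Among the others, one of largest order, [z], lies in
    [<[x]>], so [#[z]] properly divides [#[x]], and induction bounds the rest by [chi #[z]]. *)
Lemma power_clique_bound A x : power_clique A -> x \in A ->
  {in A, forall y, #[y]%g <= #[x]%g} -> #|A| <= chi #[x]%g.
Proof.
have [m] := ubnP #[x]%g; elim: m A x => // m IHm A x lt_xm clA xA max_x.
pose B := [set y in A | #[y]%g == #[x]%g].
have leB : #|B| <= totient #[x]%g.
  rewrite totient_gen subset_leq_card //; apply/subsetP=> y.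
  rewrite !inE /generator => /andP[yA /eqP eq_o]; rewrite eq_sym.
  have [yx | xy] := orP (clA _ _ yA xA).
    by rewrite (cycle_eq_order yx).
  by rewrite -(cycle_eq_order xy).
rewrite -(cardsID B A) (setIidPr _); last by apply/subsetP=> y; case/setIdP.
have [-> | [z0 z0AB]] := set_0Vmem (A :\: B).
  by rewrite cards0 addn0 (leq_trans leB) ?totient_le_chi.
have [z zAB max_z] := @arg_maxnP _ z0 (mem (A :\: B)) (fun y => #[y]%g) z0AB.
have /setDP[zA] := zAB; rewrite inE zA /= => neq_zx.
have lt_zx : #[z]%g < #[x]%g by rewrite ltn_neqAle neq_zx max_x.
have zx : z \in <[x]>%g.
  case/orP: (clA _ _ zA xA) => // xz.
  by have := dvdn_leq (order_gt0 z) (order_dvdG xz); rewrite leqNgt lt_zx.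
apply: leq_trans (chi_proper_dvd (order_gt0 x) (order_dvdG zx) lt_zx).
rewrite leq_add ?IHm //; first exact: leq_trans lt_zx _.
by move=> u v /setDP[uA _] /setDP[vA _]; apply: clA.
Qed.

(** The generators of [<[x]>] are joined to a clique built inside [<[x ^+ p]>], with [p] the least
    prime of [#[x]], following the recursion of [chi]. *)
Lemma power_clique_exists x :
  exists A, [/\ A \subset <[x]>%g, power_clique A & #|A| = chi #[x]%g].
Proof.
have [m] := ubnP #[x]%g; elim: m x => // m IHm x lt_xm.
pose B := [set y | generator <[x]>%g y].
have genB y : y \in B -> <[y]>%g = <[x]>%g.
  by rewrite inE => /eqP.
have BE y : y \in B -> y \in <[x]>%g by move=> /genB <-; apply: cycle_id.
have cardB : #|B| = totient #[x]%g by rewrite totient_gen cardsE.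
have [x_le1 | x_gt1] := leqP #[x]%g 1.
  exists B; split; first by apply/subsetP.
    by move=> y z /BE yx /genB ->; rewrite yx.
  have /eqP x1 : #[x]%g == 1 by rewrite eqn_leq x_le1 order_gt0.
  by rewrite cardB x1 chi1.
set p := pdiv #[x]%g; have p_x : p %| #[x]%g := pdiv_dvd _.
have ox : #[x ^+ p]%g = #[x]%g %/ p by rewrite orderXdiv.
have lt_ox : #[x ^+ p]%g < #[x]%g.
  by rewrite ox ltn_Pdiv ?order_gt0 ?prime_gt1 ?pdiv_prime.
have [A [sAx clA cardA]] := IHm _ (leq_trans lt_ox lt_xm).
have AE y : y \in A -> y \in <[x]>%g.
  by move=> /(subsetP sAx); apply/subsetP; rewrite cycle_subG mem_cycle.
exists (B :|: A); split.
- by apply/subsetP=> y /setUP[/BE | /AE].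
- move=> y z /setUP[By | Ay] /setUP[Bz | Az]; last exact: clA.
  + by rewrite (genB z) ?BE.
  + by rewrite (genB y) // AE ?orbT.
  + by rewrite (genB z) // AE.
rewrite chi_pdiv // -/p -ox -cardA -cardB cardsU.
(* Orders in [A] divide [#[x ^+ p] < #[x]], whereas elements of [B] have order [#[x]]. *)
suff -> : B :&: A = set0 by rewrite cards0 subn0.
apply/setP=> y; rewrite in_setI in_set0; apply/andP=> [[By Ay]].
have := dvdn_leq (order_gt0 _) (order_dvdG (subsetP sAx y Ay)).
by rewrite /order (genB y By) -/(order x) leqNgt lt_ox.
Qed.

Lemma embeds_complete_power n :
  embeds (complete_graph n) (power_graph gT) <->
  exists2 A : {set gT}, power_clique A & n <= #|A|.
Proof.
split=> [[f f_inj f_edge] | [A clA le_nA]].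
  exists [set f i | i : 'I_n]; last by rewrite card_imset // card_ord.
  move=> _ _ /imsetP[i _ ->] /imsetP[j _ ->].
  have [<- | neq_ij] := eqVneq i j; first by rewrite cycle_id.
  by have /andP[] := f_edge i j neq_ij.
have f_inj : injective (fun i : 'I_n => enum_val (widen_ord le_nA i)).
  by move=> i j /enum_val_inj /(congr1 val) /= /val_inj.
exists (fun i : 'I_n => enum_val (widen_ord le_nA i)) => // i j neq_ij.
by rewrite /= /power_edge (inj_eq f_inj) clA ?enum_valP ?andbT.
Qed.

Lemma embeds_complete_powerP n : 0 < n ->
  embeds (complete_graph n) (power_graph gT) <-> exists x, n <= chi #[x]%g.
Proof.
move=> n_gt0; split=> [/embeds_complete_power[A clA le_nA] | [x le_nx]].
  have /card_gt0P[x0 x0A] := leq_trans n_gt0 le_nA.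
  have [x xA max_x] := @arg_maxnP _ x0 (mem A) (fun y => #[y]%g) x0A.
  by exists x; apply: leq_trans le_nA _; apply: power_clique_bound.
have [A [_ clA cardA]] := power_clique_exists x.
by apply/embeds_complete_power; exists A; rewrite // cardA.
Qed.

End Cliques.

(** * Minimal order and optimal groups *)

Lemma embeds_in_order_complete n k : 0 < n -> 0 < k -> n <= chi k ->
  embeds_in_order (complete_graph n) k.
Proof.
(* The successor form gives the ordinals their additive cyclic group structure, generated by
   [Zp1]. *)
case: k => // k n_gt0 _ le_nk; exists 'I_k.+1; first by rewrite card_ord.
apply/embeds_complete_powerP => //; exists Zp1.
by rewrite /order -Zp_cycle cardsT card_ord.
Qed.

Theorem theorem2p4 (n : nat) (n_gt0 : 0 < n) :
  is_min (fun k => 0 < k /\ n <= chi k) (power_index (complete_graph n)) /\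
  (forall gT : finGroupType,
     optimal (complete_graph n) gT <->
     (cyclic [set: gT] /\ #|gT| = power_index (complete_graph n))).
Proof.
rewrite /optimal /power_index; case: ex_minnP => m /asboolP[gT oG emb] min_m.
have le_m k : 0 < k -> n <= chi k -> m <= k.
  by move=> k_gt0 le_nk; apply/min_m/asboolP/embeds_in_order_complete.
(* An embedding gives [x] with [n <= chi #[x]], hence [m <= #[x] <= #|hT| = m]: such an [x]
   generates the group. *)
have opt (hT : finGroupType) : #|hT| = m ->
    embeds (complete_graph n) (power_graph hT) ->
    exists x : hT, #[x]%g = m /\ n <= chi m.
  move=> oH /(embeds_complete_powerP _ n_gt0)[x le_nx]; exists x.
  suff ox : #[x]%g = m by rewrite -[in chi m]ox.
  by apply/eqP; rewrite eqn_leq le_m ?order_gt0 // -oH max_card.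
have [x [ox le_nm]] := opt gT oG emb.
split=> [|hT].
  by split=> [|k [k_gt0 le_nk]]; [rewrite -{1}ox order_gt0 | apply: le_m].
split=> [[embH oH] | [/cyclicP[y defH] oH]]; split=> //.
  have [y [oy _]] := opt hT oH embH; apply/cyclicP; exists y; apply/eqP.
  by rewrite eq_sym eqEcard subsetT cardsT oH -oy /order /=.
apply/embeds_complete_powerP => //; exists y.
by rewrite /order -defH cardsT oH.
Qed.
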